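(* Let $\Bbbk$ be a field of characteristic zero and let $A$ and $B$ be $\Bbbk$-algebras with $A\neq\Bbbk1_A$ and $B\neq\Bbbk1_B$. If the traces of the finite-dimensional representations of $A*B$ separate $(A*B)_{\natural}$, i.e. for every nonzero $\xi=\overline{x}\in(A*B)_{\natural}$ (with $x\in A*B$) there is a finite-dimensional representation $\rho$ of $A*B$ with $\operatorname{tr}(\rho(x))\neq0$, then $A*B$ is residually finite-dimensional (RFD).
   Context: An algebra means a nonzero associative unital $\Bbbk$-algebra. A finite-dimensional representation of an algebra $C$ is a unital $\Bbbk$-algebra homomorphism $\rho\colon C\to\operatorname{End}_{\Bbbk}(V)$ with $V$ a nonzero finite-dimensional $\Bbbk$-vector space. An algebra $C$ is residually finite-dimensional (RFD) if for every nonzero $c\in C$ there is a finite-dimensional representation $\rho$ of $C$ with $\rho(c)\neq0$. The cocenter of $C$ is the vector space $C_{\natural}:=C/[C,C]$, where $[C,C]$ is the $\Bbbk$-linear span of all commutators $xy-yx$ with $x,y\in C$; the class of $c\in C$ is denoted $\overline c$. The free product $A*B$ is the coproduct of $A$ and $B$ in the category of unital $\Bbbk$-algebras. *)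

(* Defs.v *)
From HB Require Import structures.
From mathcomp Require Import all_boot all_order all_algebra.
From mathcomp Require Import generic_quotient ring_quotient.
From mathcomp Require Import boolp.

Set Implicit Arguments.
Unset Strict Implicit.
Unset Printing Implicit Defensive.

Import GRing.Theory passmx.
Local Open Scope ring_scope.
Local Open Scope quotient_scope.

(* Algebras are MathComp [algType]s: associative, unital and nonzero. *)

(* The coproduct property in the category of unital k-algebras. The zero
   algebra is not an [algType], but it is terminal, so testing against it
   would add nothing. *)
Definition is_free_product (k : fieldType) (A B AB : algType k)
    (iA : {lrmorphism A -> AB}) (iB : {lrmorphism B -> AB}) : Prop :=
  forall (C : algType k) (f : {lrmorphism A -> C}) (g : {lrmorphism B -> C}),
    exists h : {lrmorphism AB -> C},
      [/\ h \o iA =1 f, h \o iB =1 g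
        & forall h' : {lrmorphism AB -> C},
            h' \o iA =1 f -> h' \o iB =1 g -> h' =1 h].

Definition eq_scalars (k : fieldType) (A : algType k) : Prop :=
  forall a : A, exists c : k, a = c%:A.

(* 'End(V) carries no canonical ring structure for a general V : vectType k
   (V might be zero), so multiplicativity is stated with composition. *)
Record fd_rep (k : fieldType) (C : algType k) := FdRep {
  rep_space : vectType k;
  rep_fun :> C -> 'End(rep_space);
  rep_space_neq0 : \dim {: rep_space} != 0%N;
  rep_linear : linear rep_fun;
  rep_one : rep_fun 1 = \1%VF;
  rep_mul : forall x y, rep_fun (x * y) = (rep_fun x \o rep_fun y)%VF
}.

(* [mxof] acts on row vectors, so it is the transpose of the column-convention
   matrix; the trace is unaffected. *)
Definition lftrace (k : fieldType) (V : vectType k) (f : 'End(V)) : k :=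
  \tr (mxof (vbasis {:V}) (vbasis {:V}) f).

Lemma lftrace_basis (k : fieldType) (V : vectType k)
    (e : (\dim {:V}).-tuple V) (f : 'End(V)) :
  basis_of {:V} e -> lftrace f = \tr (mxof e e f).
Proof.
move=> e_basis; have b_basis := vbasisP {:V}; rewrite /lftrace.
set b := vbasis _ in b_basis *.
have -> : mxof b b f = mxof b e \1 *m mxof e e f *m mxof e b \1.
  by rewrite -!mxof_comp // comp_lfun1l comp_lfun1r.
rewrite mxtrace_mulC mulmxA -mxof_comp // comp_lfun1l mxof1 ?mul1mx //.
exact: basis_free e_basis.
Qed.

Definition RFD (k : fieldType) (C : algType k) : Prop :=
  forall c : C, c <> 0 -> exists rho : fd_rep C, rho c <> 0.

Section Cocenter.
Variables (k : fieldType) (C : algType k).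

Definition commutator_span : {pred C} := fun z : C =>
  `[< exists s : seq (k * (C * C)),
        z = \sum_(p <- s) p.1 *: (p.2.1 * p.2.2 - p.2.2 * p.2.1) >].

Lemma commutator_spanZ (a : k) (z : C) :
  z \in commutator_span -> a *: z \in commutator_span.
Proof.
move=> /asboolP[s ->]; apply/asboolP.
exists [seq (a * p.1, p.2) | p <- s].
by rewrite big_map scaler_sumr; apply: eq_bigr => p _; rewrite scalerA.
Qed.

Lemma commutator_span_zmod_closed : zmod_closed commutator_span.
Proof.
split=> [|x y xS yS]; first by apply/asboolP; exists [::]; rewrite big_nil.
have := commutator_spanZ (-1) yS; rewrite scaleN1r => /asboolP[t ty].
move/asboolP: xS => [s ->]; rewrite ty; apply/asboolP.
by exists (s ++ t); rewrite big_cat.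
Qed.

HB.instance Definition _ :=
  GRing.isZmodClosed.Build C commutator_span commutator_span_zmod_closed.

Definition cocenter : Type := {ideal_quot commutator_span}.

HB.instance Definition _ := GRing.Zmodule.on cocenter.
HB.instance Definition _ := ZmodQuotient.on cocenter.

Lemma cocenter_eq0 (x : C) :
  (\pi_cocenter x == 0) = (x \in commutator_span).
Proof.
by rewrite -[x in RHS]subr0 Quotient.idealrBE -[RHS]/(\pi_cocenter x == \pi_cocenter 0) raddf0.
Qed.

Definition cocenter_scale (a : k) : cocenter -> cocenter :=
  lift_op1 cocenter ( *:%R a).

Lemma pi_cocenter_scale (a : k) :
  {morph \pi_cocenter : x / a *: x >-> cocenter_scale a x}.
Proof.
move=> x; unlock cocenter_scale; apply/eqP.
rewrite -subr_eq0 -raddfB /= cocenter_eq0 -scalerBr.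
by apply: commutator_spanZ; rewrite -cocenter_eq0 raddfB /= reprK subrr.
Qed.

Fact cocenter_scalerA (a b : k) (u : cocenter) :
  cocenter_scale a (cocenter_scale b u) = cocenter_scale (a * b) u.
Proof. by elim/quotW: u => x; rewrite -!pi_cocenter_scale scalerA. Qed.

Fact cocenter_scale1r : left_id 1 cocenter_scale.
Proof. by elim/quotW=> x; rewrite -pi_cocenter_scale scale1r. Qed.

Fact cocenter_scalerDr : right_distributive cocenter_scale +%R.
Proof.
move=> a; elim/quotW=> x; elim/quotW=> y.
by rewrite -!pi_cocenter_scale -raddfD -pi_cocenter_scale scalerDr raddfD.
Qed.

Fact cocenter_scalerDl (u : cocenter) :
  {morph cocenter_scale^~ u : a b / a + b}.
Proof.
by move=> a b; elim/quotW: u => x; rewrite -!pi_cocenter_scale scalerDl raddfD.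
Qed.

HB.instance Definition _ := GRing.Zmodule_isLmodule.Build k cocenter
  cocenter_scalerA cocenter_scale1r cocenter_scalerDr cocenter_scalerDl.

End Cocenter.

Definition cocenter_class (k : fieldType) (C : algType k) (x : C) : cocenter C :=
  \pi_(cocenter C) x.

Definition traces_separate_cocenter (k : fieldType) (C : algType k) : Prop :=
  forall x : C, cocenter_class x <> 0 ->
    exists rho : fd_rep C, lftrace (rho x) <> 0.

(* Main.v *)
Require Import Defs.
From HB Require Import structures.
From mathcomp Require Import all_boot all_order all_algebra.
From mathcomp Require Import boolp classical_sets functions.

Set Implicit Arguments.
Unset Strict Implicit.
Unset Printing Implicit Defensive.

Import GRing.Theory.
Local Open Scope ring_scope.

(** It suffices to find, for each x <> 0 in A*B, a product p x r outside
    [A*B, A*B]: a representation whose trace is nonzero at p x r cannot kill x.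
    Fix bases of A and B containing 1, so that alternating words in the other
    basis elements span A*B. There is a derivation d from A*B to Hom(A*B, A*B),
    with bimodule structure (x.T.y)(z) = T(y z x), such that
    d(a)(z) = z a - a z and d(b) = 0. Then theta(c) := d(c)(1) satisfies
    theta(xy) = d(x)(y) + d(y)(x) = theta(yx), hence vanishes on commutators; on
    a word it is a signed sum of cyclic rotations. Let w1 be a longest word
    occurring in x, extend it to an alternating word w0 = p w1 q that starts in
    A and ends in B, and let e be the coefficient functional of w0 w0. If a
    rotation of p w q w0 is w0 w0, then p w q = w0 and so w = w1. Hence
    e(theta(p x q w0)) is, up to sign, the coefficient of w1 in x times a
    positive number of rotations, which is nonzero in characteristic zero. *)

(** * Bases containing a prescribed nonzero vector *)

(** The linear extensions [bext] encode freeness. The [Some] indices will be the letters of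
    words. *)
Record pointed_basis (k : fieldType) (V : lmodType k) (v0 : V) := PointedBasis {
  bidx : choiceType;
  bvec : option bidx -> V;
  bext : (option bidx -> k) -> V -> k;
  bvec_None : bvec None = v0;
  bext_linear : forall g, linear (bext g : V -> k^o);
  bext_vec : forall g o, bext g (bvec o) = g o;
  bvec_span : forall v, exists s : seq (k * option bidx),
    v = \sum_(p <- s) p.1 *: bvec p.2
}.

Arguments bvec {k V v0} p o.
Arguments bext {k V v0} p g v.
Arguments bext_linear {k V v0} p g.

Section Basis.
Variables (k : fieldType) (V : lmodType k) (v0 : V).
Hypothesis v0_neq0 : v0 != 0.
Local Open Scope classical_set_scope.

Let over (X : set V) (s : seq (k * V)) := forall p, p \in s -> X p.2.
Let lc (s : seq (k * V)) : V := \sum_(p <- s) p.1 *: p.2.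

(* Quantifying over all g avoids requiring the vectors in s to be distinct. *)
Let indep (X : set V) := forall s, over X s -> lc s = 0 ->
  forall g : V -> k, \sum_(p <- s) p.1 * g p.2 = 0.

(** A combination involves finitely many vectors, so a single member of the chain holds all those
    other than [v0], if there are any. *)
Let over_chain (F : set (set V)) (s : seq (k * V)) :
  total_on F subset -> over (\bigcup_(X in F) X `|` [set v0]) s ->
  over [set v0] s \/ exists2 X, F X & over (X `|` [set v0]) s.
Proof.
move=> Ftot; elim: s => [|p s IHs] ov; first by left.
have [|ov0|[X FX ovX]] := IHs; first by move=> q qs; apply: ov; rewrite inE qs orbT.
  case: (ov p (mem_head _ _)) => [[X FX Xp]|p0]; [right; exists X => //|left].
    by move=> q; rewrite inE => /predU1P[->|/ov0]; [left|right].
  by move=> q; rewrite inE => /predU1P[->|/ov0].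
right; case: (ov p (mem_head _ _)) => [[Y FY Yp]|p0]; last first.
  by exists X => // q; rewrite inE => /predU1P[->|/ovX//]; right.
have [XY|YX] := Ftot _ _ FX FY.
  exists Y => // q; rewrite inE => /predU1P[->|/ovX[/XY|]]; by [left|left|right].
by exists X => // q; rewrite inE => /predU1P[->|/ovX//]; left; apply: YX.
Qed.

Let indep1 : indep [set v0].
Proof.
move=> s ov s0 g.
have -> : \sum_(p <- s) p.1 * g p.2 = (\sum_(p <- s) p.1) * g v0.
  by rewrite mulr_suml; apply: eq_big_seq => p /ov ->.
suff /eqP : (\sum_(p <- s) p.1) *: v0 = 0.
  by rewrite scaler_eq0 (negPf v0_neq0) orbF => /eqP ->; rewrite mul0r.
by rewrite scaler_suml -[RHS]s0; apply: eq_big_seq => p /ov ->.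
Qed.

Lemma exists_pointed_basis : exists _ : pointed_basis v0, True.
Proof.
have [] := @Zorn_bigcup V (fun X => indep (X `|` [set v0])).
  move=> F FP Ftot s ov s0; have [ov1|[X FX ovX]] := over_chain Ftot ov.
    exact: indep1.
  exact: (FP X).
move=> X [Xind Xmax]; set Y := X `|` [set v0] in Xind.
have Yspan v : exists s, over Y s /\ v = lc s.
  (* A [v] outside the span could be added to [X], against maximality: its total coefficient [c] in
     a vanishing combination is zero. *)
  apply: contrapT => nv; apply: (Xmax (X `|` [set v])).
    split; first by move=> x; left.
    apply: contra_not nv => /(_ v (or_intror erefl)) Xv.
    exists [:: (1, v)]; split; last by rewrite /lc big_seq1 scale1r.
    by move=> q; rewrite inE => /eqP ->; left.
  move=> s ov s0 g.
  pose t := [seq p <- s | p.2 != v]; pose c := \sum_(p <- s | p.2 == v) p.1.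
  have ovt : over Y t.
    move=> p; rewrite mem_filter => /andP[/eqP pv /ov[[]|]] //; by [left|right].
  have st : c *: v + lc t = 0.
    rewrite -[RHS]s0 /lc /t [RHS](bigID (fun p => p.2 == v)) /= big_filter scaler_suml.
    by congr (_ + _); apply: eq_bigr => p /eqP ->.
  have c0 : c = 0.
    apply: contrapT => /eqP c0; apply: nv.
    exists [seq (- c^-1 * p.1, p.2) | p <- t]; split.
      by move=> _ /mapP[p /ovt pY ->].
    apply: (scalerI c0); rewrite /lc big_map scaler_sumr.
    move/eqP: st; rewrite addr_eq0 => /eqP ->; rewrite -sumrN.
    by apply: eq_bigr => p _ /=; rewrite !scalerA mulrA mulrN divff // mulN1r scaleNr.
  rewrite (bigID (fun p => p.2 == v)) /= -[X in _ + X]big_filter.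
  rewrite (Xind t) // ?addr0; last by rewrite -st c0 scale0r add0r.
  rewrite (eq_bigr (fun p => p.1 * g v)) => [|p /eqP -> //].
  by rewrite -mulr_suml -/c c0 mul0r.
(* The maximal [X] may contain [v0], already indexed by [None]; removing it keeps [vec]
   injective. *)
pose I : choiceType := {x : V | `[< X x /\ x <> v0 >]}.
pose vec (o : option I) := if o is Some i then val i else v0.
have vecY o : Y (vec o).
  by case: o => [[x /= /asboolP[Xx _]]|]; [left|right].
have vecP y : Y y -> exists o, vec o = y.
  have [-> _|/eqP yv0 [Xy|//]] := eqVneq y v0; first by exists None.
  have hy : `[< X y /\ y <> v0 >] by apply/asboolP.
  by exists (Some (exist _ y hy)).
have vec_inj : injective vec.
  move=> [i|] [j|] //=.
  - by move/val_inj ->.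
  - by have /asboolP[_ iv0] := valP i => /iv0.
  - by have /asboolP[_ jv0] := valP j => /esym/jv0.
have [rep repP] := choice Yspan.
pose onV (g : option I -> k) (v : V) : k :=
  if pselect (exists o, vec o = v) is left h then g (sval (cid h)) else 0.
have onVE g o : onV g (vec o) = g o.
  rewrite /onV; case: pselect => [h|[]]; last by exists o.
  by case: (cid h) => o' /= /vec_inj ->.
pose ext g v := \sum_(p <- rep v) p.1 * onV g p.2.
(* Independence is applied to the difference of two representations: [ext] does not depend on the
   choice of [rep]. *)
have extE g s : over Y s -> ext g (lc s) = \sum_(p <- s) p.1 * onV g p.2.
  move=> ov; have [ovr rs] := repP (lc s).
  apply/eqP; rewrite -subr_eq0; apply/eqP.
  pose t := rep (lc s) ++ [seq (- p.1, p.2) | p <- s].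
  have <- : \sum_(p <- t) p.1 * onV g p.2 =
            ext g (lc s) - \sum_(p <- s) p.1 * onV g p.2.
    rewrite big_cat big_map /= -sumrN; congr (_ + _).
    by apply: eq_bigr => p _; rewrite mulNr.
  apply: Xind; first by move=> p; rewrite mem_cat => /orP[/ovr//|/mapP[q /ov qY ->]].
  rewrite /lc big_cat big_map -/(lc _) -rs; apply/eqP; rewrite addr_eq0 -sumrN.
  by apply/eqP/eq_bigr => p _; rewrite scaleNr opprK.
have extD g : linear (ext g : V -> k^o).
  move=> a u v; have [ou {1}->] := repP u; have [ovv {1}->] := repP v.
  pose t := [seq (a * p.1, p.2) | p <- rep u] ++ rep v.
  have -> : a *: lc (rep u) + lc (rep v) = lc t.
    rewrite /lc big_cat big_map scaler_sumr; congr (_ + _).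
    by apply: eq_bigr => p _; rewrite scalerA.
  rewrite extE; last first.
    by move=> p; rewrite mem_cat => /orP[/mapP[q /ou ? ->]|/ovv].
  rewrite big_cat big_map /ext /= [_ *: _]mulr_sumr; congr (_ + _).
  by apply: eq_bigr => p _; rewrite mulrA.
unshelve eexists (@PointedBasis k V v0 I vec ext _ extD _ _) => //.
  move=> g o; have -> : vec o = lc [:: (1, vec o)] by rewrite /lc big_seq1 scale1r.
  rewrite extE ?big_seq1 /= ?mul1r //.
  by move=> p; rewrite inE => /eqP ->; apply: vecY.
move=> v; have [ov {1}->] := repP v; elim: (rep v) ov => [|p s IHs] ov.
  by exists [::]; rewrite /lc !big_nil.
have [|t st] := IHs; first by move=> q qs; apply: ov; rewrite inE qs orbT.
have [o op] := vecP _ (ov p (mem_head _ _)).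
by exists ((p.1, o) :: t); rewrite big_cons -st /lc big_cons op.
Qed.

End Basis.

(** * The algebra of linear endomorphisms *)

Section Endo.
Variables (k : fieldType) (V : lmodType k).

Definition is_linear_map : {pred V -> V} := fun f => `[< linear f >].

Lemma is_linear_map_submod : submod_closed is_linear_map.
Proof.
split=> [|c f g /asboolP lf /asboolP lg]; apply/asboolP => a u v.
  by rewrite scaler0 addr0.
have E w : (c *: f + g) w = c *: f w + g w by [].
rewrite !E lf lg !scalerDr !scalerA [c * a]mulrC.
by rewrite addrACA.
Qed.

HB.instance Definition _ :=
  GRing.isSubmodClosed.Build k (V -> V) is_linear_map is_linear_map_submod.

Record endo := Endo { endo_fun :> V -> V; endoP : endo_fun \in is_linear_map }.

HB.instance Definition _ := [isSub for endo_fun].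
HB.instance Definition _ := [Choice of endo by <:].
HB.instance Definition _ := [SubChoice_isSubLmodule of endo by <:].

Lemma endo_linear (f : endo) : linear f.
Proof. exact/asboolP/(endoP f). Qed.

Lemma endo_eqP (f g : endo) : f =1 g -> f = g.
Proof. by move=> fg; apply/val_inj/funext. Qed.

Fact id_is_linear_map : id \in is_linear_map.
Proof. exact/asboolP. Qed.

Fact comp_is_linear_map (f g : endo) : f \o g \in is_linear_map.
Proof. by apply/asboolP => a u v /=; rewrite !endo_linear. Qed.

Lemma endo0 (f : endo) : f 0 = 0.
Proof.
have /esym/eqP := endo_linear f 1 0 0.
by rewrite !scale1r addr0 -subr_eq0 addrK => /eqP.
Qed.
End Endo.

Section EndoAlgebra.
Variables (k : fieldType) (V : lmodType k) (v0 : V).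
Hypothesis v0_neq0 : v0 != 0.

(* [v0_neq0] is a parameter because an [algType] must be nonzero. *)
Definition endo_alg of v0 != 0 : Type := endo V.
Notation E := (endo_alg v0_neq0).

HB.instance Definition _ := GRing.Lmodule.on E.

Let mul (f g : E) : E := Endo (comp_is_linear_map f g).
Let one : E := Endo (id_is_linear_map V).

Fact endo_mulA : associative mul. Proof. by move=> f g h; apply: endo_eqP. Qed.
Fact endo_mul1r : left_id one mul. Proof. by move=> f; apply: endo_eqP. Qed.
Fact endo_mulr1 : right_id one mul. Proof. by move=> f; apply: endo_eqP. Qed.
Fact endo_mulDl : left_distributive mul +%R.
Proof. by move=> f g h; apply: endo_eqP. Qed.
Fact endo_mulDr : right_distributive mul +%R.
Proof.
move=> f g h; apply: endo_eqP => v; have := endo_linear f 1 (g v) (h v).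
by rewrite !scale1r.
Qed.
Fact endo_one_neq0 : one != 0.
Proof.
apply/eqP => /(congr1 (fun f : endo V => f v0)) /= v00.
by move: v0_neq0; rewrite v00 eqxx.
Qed.

HB.instance Definition _ := GRing.Zmodule_isNzRing.Build E
  endo_mulA endo_mul1r endo_mulr1 endo_mulDl endo_mulDr endo_one_neq0.

Fact endo_scaleAl (a : k) (f g : E) : a *: (f * g) = (a *: f) * g.
Proof. exact: endo_eqP. Qed.
Fact endo_scaleAr (a : k) (f g : E) : a *: (f * g) = f * (a *: g).
Proof.
apply: endo_eqP => v; have := endo_linear f a (g v) 0.
by rewrite !addr0 endo0 addr0.
Qed.

HB.instance Definition _ := GRing.LSemiModule_isLSemiAlgebra.Build k E endo_scaleAl.
HB.instance Definition _ := GRing.LSemiAlgebra_isSemiAlgebra.Build k E endo_scaleAr.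
End EndoAlgebra.

(** * Induction and actions from the universal property *)

Lemma exists_lrmorphism (k : fieldType) (A C : algType k) (f : A -> C) :
  linear f -> f 1 = 1 -> {morph f : x y / x * y} ->
  exists h : {lrmorphism A -> C}, h =1 f.
Proof.
move=> f_lin f1 fM.
pose l := GRing.isLinear.Build k A C *:%R f f_lin.
pose m := GRing.isMonoidMorphism.Build A C f (conj f1 fM).
pose h : {lrmorphism A -> C} := HB.pack f l m.
by exists h.
Qed.

Section Subalgebra.
Variables (k : fieldType) (C : algType k) (S : {pred C}).
Hypothesis Salg : subalg_closed S.

Definition subalg_of of subalg_closed S : Type := {x : C | x \in S}.
Notation U := (subalg_of Salg).

HB.instance Definition _ := SubChoice.on U.
HB.instance Definition _ :=
  GRing.SubChoice_isSubAlgebra.Build k C S U (GRing.subalg_closed_semi Salg).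

End Subalgebra.

(** Corestrict [iA] and [iB] to the subalgebra [S], lift to [AB] and include back: this endomorphism
    of [AB] agrees with the identity on both factors, hence everywhere by uniqueness. *)
Lemma free_product_ind (k : fieldType) (A B AB : algType k)
    (iA : {lrmorphism A -> AB}) (iB : {lrmorphism B -> AB}) (S : {pred AB}) :
  is_free_product iA iB -> subalg_closed S ->
  (forall a, iA a \in S) -> (forall b, iB b \in S) -> forall x, x \in S.
Proof.
move=> freeAB Salg SA SB x.
pose U := subalg_of Salg.
have lift (D : algType k) (i : {lrmorphism D -> AB}) (Si : forall d, i d \in S) :
    exists h : {lrmorphism D -> U}, forall d, val (h d) = i d :> AB.
  have [|||h hE] := @exists_lrmorphism k D U (fun d => exist _ (i d) (Si d)).
  - by move=> a u v; apply: val_inj; rewrite /= !linearP.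
  - by apply: val_inj; rewrite /= !rmorph1.
  - by move=> u v; apply: val_inj; rewrite /= !rmorphM.
  by exists h => d; rewrite hE.
have [f fE] := lift _ _ SA; have [g gE] := lift _ _ SB.
have [h [hf hg _]] := freeAB U f g.
have [j [_ _ j_uniq]] := freeAB AB iA iB.
have <- : val (h x) = x :> AB; last exact: valP.
have [|||vh vhE] := @exists_lrmorphism k AB AB (fun x => val (h x)).
- by move=> a u v; rewrite !linearP.
- by rewrite !rmorph1.
- by move=> u v; rewrite !rmorphM.
rewrite -vhE (j_uniq vh); first by rewrite -(j_uniq idfun).
- by move=> a; have /= := hf a; rewrite /= vhE => ->.
- by move=> b; have /= := hg b; rewrite /= vhE => ->.
Qed.

Definition is_action (k : fieldType) (A : algType k) (V : lmodType k)
    (f : A -> V -> V) :=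
  [/\ forall v, linear (f^~ v), forall a, linear (f a), forall v, f 1 v = v
    & forall a b v, f (a * b) v = f a (f b v)].

(** Each action is a morphism into the endomorphism algebra of [V]; the universal property joins the
    two. *)
Lemma free_product_action (k : fieldType) (A B AB : algType k)
    (iA : {lrmorphism A -> AB}) (iB : {lrmorphism B -> AB}) (V : lmodType k)
    (v0 : V) (fA : A -> V -> V) (fB : B -> V -> V) :
  is_free_product iA iB -> v0 != 0 -> is_action fA -> is_action fB ->
  exists f : AB -> V -> V,
    [/\ is_action f, forall a, f (iA a) = fA a & forall b, f (iB b) = fB b].
Proof.
move=> freeAB v0_neq0 fAact fBact.
pose E := endo_alg v0_neq0.
have lift (D : algType k) (g : D -> V -> V) : is_action g ->
    exists h : {lrmorphism D -> E}, forall d, (h d : endo V) = g d :> (V -> V).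
  move=> [gl gV g1 gM].
  have gE d : g d \in is_linear_map (V:=V) by apply/asboolP/gV.
  have [|||h hE] := @exists_lrmorphism k D E (fun d => Endo (gE d)).
  - by move=> a u v; apply: endo_eqP => x; apply: gl.
  - by apply: endo_eqP => x; apply: g1.
  - by move=> a b; apply: endo_eqP => x; apply: gM.
  by exists h => d; rewrite hE.
have [hA hAE] := lift _ _ fAact; have [hB hBE] := lift _ _ fBact.
have [h [hhA hhB _]] := freeAB E hA hB.
exists (fun x => (h x : endo V)); split; [split| |].
- by move=> v a x y; rewrite linearP.
- by move=> x; apply: endo_linear.
- by move=> v; rewrite rmorph1.
- by move=> a b v; rewrite rmorphM.
- by move=> a; rewrite -hAE -hhA.
- by move=> b; rewrite -hBE -hhB.
Qed.

(** * One factor acting on functions of words *)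

Section PointedBasisTheory.
Variables (k : fieldType) (V : lmodType k) (v0 : V) (bV : pointed_basis v0).

Lemma bext_uniq (phi : V -> k) g :
  linear (phi : V -> k^o) -> (forall o, phi (bvec bV o) = g o) ->
  forall v, phi v = bext bV g v.
Proof.
move=> phi_lin phiE v; have [s ->] := bvec_span bV v.
pose l1 : {linear V -> k^o} := HB.pack phi
  (GRing.isLinear.Build k V k^o *:%R phi phi_lin).
pose l2 : {linear V -> k^o} := HB.pack (bext bV g)
  (GRing.isLinear.Build k V k^o *:%R (bext bV g) (bext_linear bV g)).
rewrite -[LHS]/(l1 _) -[RHS]/(l2 _) !linear_sum; apply: eq_bigr => p _.
by rewrite !linearZ /= phiE bext_vec.
Qed.

Lemma bext0 g v : (forall o, g o = 0) -> bext bV g v = 0.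
Proof.
move=> g0; rewrite -(@bext_uniq (fun=> 0)) //.
by move=> a x y; rewrite scaler0 addr0.
Qed.

Lemma bext_linear_fun a g h v :
  bext bV (fun o => a * g o + h o) v = a * bext bV g v + bext bV h v.
Proof.
rewrite -(@bext_uniq (fun v => a * bext bV g v + bext bV h v)) => [//||o].
  move=> c x y; have scE (p q : k) : p *: (q : k^o) = p * q by [].
  by rewrite !bext_linear !scE !mulrDr addrACA (mulrCA a c).
by rewrite !bext_vec.
Qed.

End PointedBasisTheory.

Section WordAction.
Variables (k : fieldType) (A : algType k) (bA : pointed_basis (1 : A)).
Variables (T : Type) (inj : bidx bA -> T) (sel : T -> option (bidx bA)).
Hypotheses (injK : pcancel inj sel) (selK : ocancel sel inj).

(* Parity of the length of the maximal prefix of letters coming from A. *)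
Fixpoint odd_run (w : seq T) : bool :=
  if w is t :: w' then sel t && ~~ odd_run w' else false.

(** Each word is uniquely a base word of even run with an optional letter in front, so functions of
    words form a product of copies of the dual of [A]. Using parity covers all words, not only
    alternating ones, and lets both factors act on one space. *)
Definition split_word (w : seq T) : seq T * option (bidx bA) :=
  if odd_run w then (behead w, obind sel (ohead w)) else (w, None).

Definition join_word (w : seq T) (o : option (bidx bA)) : seq T :=
  if o is Some i then inj i :: w else w.

Lemma split_join w o : ~~ odd_run w -> split_word (join_word w o) = (w, o).
Proof.
by case: o => [i|] /= ew; rewrite /split_word /= ?injK ?ew // (negPf ew).
Qed.

Lemma split_base w : ~~ odd_run (split_word w).1.
Proof.
rewrite /split_word; case: ifP => [|->//]; case: w => //= t w.
by case/andP.
Qed.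

Lemma join_split w : join_word (split_word w).1 (split_word w).2 = w.
Proof.
rewrite /split_word; case: ifP => //; case: w => //= t w.
by have := selK t; case: (sel t) => //= i ->.
Qed.

(* Words are stored reversed, so that the algebra acts on functions of words
   through right multiplication by basis elements. *)
Definition word_act (a : A) (f : seq T -> k^o) : seq T -> k^o := fun w =>
  bext bA (fun o => f (join_word (split_word w).1 o)) (bvec bA (split_word w).2 * a).

(** Over a fixed base word, a function of the optional letter is a linear form on [A]; [a] sends
    [phi] to [v |-> phi (v * a)], which is a left action. *)
Lemma word_act_is_action : is_action word_act.
Proof.
split.
- move=> f a x y; apply: funext => w.
  by rewrite /word_act mulrDr -scalerAr bext_linear.
- move=> x a f g; apply: funext => w.
  by rewrite /word_act bext_linear_fun.
- move=> f; apply: funext => w.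
  by rewrite /word_act mulr1 bext_vec join_split.
- move=> a b f; apply: funext => w; rewrite /word_act mulrA.
  set g := fun o => f _; set x := _ * a.
  apply: (@bext_uniq _ _ _ _ (fun v => bext bA g (v * b))) => [c y z|o].
    by rewrite mulrDl -scalerAl bext_linear.
  by rewrite split_join // split_base.
Qed.

Lemma letter_act_cons i f w : ~~ odd_run w ->
  word_act (bvec bA (Some i)) f w = f (inj i :: w).
Proof.
by move=> ew; rewrite /word_act /split_word (negPf ew) /= bvec_None mul1r bext_vec.
Qed.

(** If the run is odd, the first letter of [w] and [i] multiply inside [A], and the product expands
    over words no longer than [w]. *)
Lemma letter_act_eq0 i f w :
  (forall v, (size v <= size w)%N -> f v = 0) -> f (inj i :: w) = 0 ->
  word_act (bvec bA (Some i)) f w = 0.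
Proof.
move=> f0 fiw; have [ow|ew] := boolP (odd_run w); last by rewrite letter_act_cons.
rewrite /word_act /split_word ow bext0 // => o; apply: f0.
by case: (w) ow => // t v _; case: o => //=.
Qed.

End WordAction.

(** * Alternating words and their coefficients *)

Section FreeProductWords.
Variables (k : fieldType) (A B AB : algType k).
Variables (iA : {lrmorphism A -> AB}) (iB : {lrmorphism B -> AB}).
Hypothesis freeAB : is_free_product iA iB.
Variables (bA : pointed_basis (1 : A)) (bB : pointed_basis (1 : B)).

Definition letter := (bidx bA + bidx bB)%type.
Implicit Types (l : letter) (s t u w : seq letter).

Definition letter_val l : AB :=
  match l with
  | inl i => iA (bvec bA (Some i))
  | inr j => iB (bvec bB (Some j))
  end.

Definition word_val s : AB := \prod_(l <- s) letter_val l.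

Definition inA l : bool := if l is inl _ then true else false.

Definition alternating : pred (seq letter) := sorted (fun l l' => inA l != inA l').

Lemma word_val_cons l s : word_val (l :: s) = letter_val l * word_val s.
Proof. exact: big_cons. Qed.

Lemma word_val_cat s t : word_val (s ++ t) = word_val s * word_val t.
Proof. exact: big_cat. Qed.

Lemma alternating_adjacent s l l' t :
  alternating (s ++ [:: l, l' & t]) -> inA l != inA l'.
Proof.
rewrite /alternating; case: s => [|x s] /=; first by case/andP.
by rewrite cat_path /= => /and4P[].
Qed.

Let selA l := if l is inl i then Some i else None.
Let selB l := if l is inr j then Some j else None.

Lemma exists_letter_action : exists f : AB -> (seq letter -> k^o) -> seq letter -> k^o,
  [/\ is_action f,
      forall l g w, (if w is l' :: _ then inA l != inA l' else true) ->
        f (letter_val l) g w = g (l :: w)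
    & forall l g w, (forall v, (size v <= size w)%N -> g v = 0) ->
        g (l :: w) = 0 -> f (letter_val l) g w = 0].
Proof.
have AK : @pcancel letter _ inl selA by [].
have KA : ocancel selA (inl : _ -> letter) by case.
have BK : @pcancel letter _ inr selB by [].
have KB : ocancel selB (inr : _ -> letter) by case.
have one0 : ((fun=> 1) : seq letter -> k^o) != 0.
  apply/eqP => /(congr1 (fun h : seq letter -> k^o => h [::])) h10.
  by have /eqP[] := oner_neq0 k.
have [f [fact fA fB]] := free_product_action freeAB one0
  (word_act_is_action AK KA) (word_act_is_action BK KB).
exists f; split=> //.
  case=> [i|j] g w hw /=; rewrite ?fA ?fB letter_act_cons //.
    by case: w hw => [|[]].
  by case: w hw => [|[]].
by case=> [i|j] g w g0 gw /=; rewrite ?fA ?fB letter_act_eq0.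
Qed.

(** Let [word_val t] act on the indicator of [u] and evaluate at the empty word: the letters of [t]
    pile up on the argument in reverse order. Words that do not alternate are covered too, since
    they arise as rotations. *)
Lemma exists_word_coef u : alternating u ->
  exists e : AB -> k, linear (e : AB -> k^o) /\
    forall t, (size t <= size u)%N -> e (word_val t) = (t == u)%:R.
Proof.
move=> altu; have [f [[f_lin _ f1 fM] f_cons f_eq0]] := exists_letter_action.
pose delta w : k^o := (rev w == u)%:R.
exists (fun x => f x delta [::]); split.
  by move=> a x y; rewrite f_lin.
suff H t w : (size w + size t <= size u)%N ->
    f (word_val t) delta w = (rev w ++ t == u)%:R.
  by move=> t tu; rewrite H.
elim: t w => [|l t IHt] w wt; first by rewrite /word_val big_nil f1 cats0.
have IH v : (size v <= (size w).+1)%N -> f (word_val t) delta v = (rev v ++ t == u)%:R.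
  move=> vw; apply: IHt; apply: leq_trans wt.
  by rewrite /= addnS -addSn leq_add2r.
have IHl : f (word_val t) delta (l :: w) = (rev w ++ l :: t == u)%:R.
  by rewrite IH // rev_cons cat_rcons.
rewrite word_val_cons fM.
have [ok|bad] := boolP (if w is l' :: _ then inA l != inA l' else true).
  by rewrite f_cons.
(* Two adjacent letters from the same factor rule out [u]; the words [v] no longer than [w] are
   ruled out by length. *)
have nu : (rev w ++ l :: t == u) = false.
  apply/negP => /eqP uE; move: bad altu; case: (w) uE => // l' w' <- /negP bad.
  rewrite rev_cons cat_rcons => /alternating_adjacent.
  by rewrite eq_sym.
rewrite f_eq0 ?nu // ?IHl ?nu // => v vw; rewrite IH ?(leqW vw) //.
have /negPf-> // : rev v ++ t != u.
apply: contraTneq wt => <-.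
by rewrite size_cat size_rev /= addnS ltnNge leq_add2r vw.
Qed.

End FreeProductWords.

(** * Derivations of the free product *)

Section TwistedAction.
Variables (k : fieldType) (D C : algType k) (i : {lrmorphism D -> C}).
Variable delta : D -> C -> C.
Hypothesis delta_lin : forall z, linear (delta^~ z).
Hypothesis delta_linr : forall a, linear (delta a).
Hypothesis delta1 : forall z, delta 1 z = 0.
Hypothesis deltaM : forall a b z,
  delta (a * b) z = delta a (i b * z) + delta b (z * i a).

Fact twist_fun_linear a (p : endo C * C) :
  linear (fun z => p.1 (z * i a) + delta a (p.2 * z)).
Proof.
move=> c x y; rewrite mulrDl -scalerAl endo_linear mulrDr -scalerAr delta_linr.
by rewrite scalerDr addrACA.
Qed.

(* The left module structure of the square-zero extension C + Hom(C, C) over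
   itself, pulled back along a |-> (i a, delta a). *)
Definition twist_act a (p : endo C * C) : endo C * C :=
  (Endo (introT (asboolP _) (twist_fun_linear a p)), i a * p.2).

Let twist_actE a p z :
  (twist_act a p).1 z = p.1 (z * i a) + delta a (p.2 * z).
Proof. by []. Qed.

Let pair_eqP (p q : endo C * C) : (forall z, p.1 z = q.1 z) -> p.2 = q.2 -> p = q.
Proof. by case: p q => [f x] [g y] /= /endo_eqP-> ->. Qed.

Lemma pair_lin (a : k) (p q : endo C * C) z : (a *: p + q).1 z = a *: p.1 z + q.1 z.
Proof. by []. Qed.

Lemma twist_act_is_action : is_action twist_act.
Proof.
split.
- move=> p c a b; apply: pair_eqP => [z|]; last by rewrite /= linearP mulrDl -scalerAl.
  rewrite pair_lin !twist_actE linearP mulrDr -scalerAr endo_linear delta_lin.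
  by rewrite scalerDr addrACA.
- move=> a c p q; apply: pair_eqP => [z|]; last by rewrite /= mulrDr -scalerAr.
  rewrite pair_lin !twist_actE pair_lin mulrDl -scalerAl delta_linr.
  by rewrite scalerDr addrACA.
- move=> p; apply: pair_eqP => [z|]; last by rewrite /= rmorph1 mul1r.
  by rewrite twist_actE rmorph1 mulr1 delta1 addr0.
- move=> a b p; apply: pair_eqP => [z|]; last by rewrite /= rmorphM mulrA.
  rewrite !twist_actE rmorphM deltaM /= !mulrA.
  by rewrite -addrA [X in _ = _ + X]addrC.
Qed.

End TwistedAction.

Section CyclicDerivative.
Variables (k : fieldType) (A B AB : algType k).
Variables (iA : {lrmorphism A -> AB}) (iB : {lrmorphism B -> AB}).
Hypothesis freeAB : is_free_product iA iB.

(** A derivation amounts to an action of the twisted form, so the commutator with the identity map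
    on [A] and zero on [B] glue by the universal property. *)
Lemma exists_double_derivation : exists d : AB -> AB -> AB,
  [/\ forall z, linear (d^~ z),
      forall x y z, d (x * y) z = d x (y * z) + d y (z * x),
      forall a z, d (iA a) z = z * iA a - iA a * z
    & forall b z, d (iB b) z = 0].
Proof.
pose dA (a : A) (z : AB) := z * iA a - iA a * z.
have dA_lin z : linear (dA^~ z).
  move=> c x y; rewrite /dA linearP mulrDr mulrDl -scalerAr -scalerAl.
  by rewrite scalerBr opprD addrACA.
have dA_linr a : linear (dA a).
  move=> c x y; rewrite /dA mulrDr mulrDl -scalerAr -scalerAl.
  by rewrite scalerBr opprD addrACA.
have dA1 z : dA 1 z = 0 by rewrite /dA rmorph1 mulr1 mul1r subrr.
have dAM a b z : dA (a * b) z = dA a (iA b * z) + dA b (z * iA a).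
  by rewrite /dA rmorphM !mulrA [RHS]addrC addrA addrNK.
pose dB (b : B) (z : AB) : AB := 0.
have dB_lin z : linear (dB^~ z) by move=> c x y; rewrite /dB scaler0 addr0.
have dB_linr b : linear (dB b) by move=> c x y; rewrite /dB scaler0 addr0.
have dB1 z : dB 1 z = 0 by [].
have dBM a b z : dB (a * b) z = dB a (iB b * z) + dB b (z * iB a).
  by rewrite /dB addr0.
have v0 : ((0, 1) : endo AB * AB) != 0.
  by apply/eqP => /(congr1 snd)/eqP; rewrite oner_eq0.
have [f [[f_lin f_linr f1 fM] fA fB]] := free_product_action freeAB v0
  (twist_act_is_action dA_lin dA_linr dA1 dAM)
  (twist_act_is_action dB_lin dB_linr dB1 dBM).
pose d x z : AB := (f x (0, 1)).1 z.
have dlin z : linear (d^~ z) by move=> c x y; rewrite /d f_lin.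
(* With [fE], this extends the twisted form from the two factors to every [x]; multiplicativity of
   [f] then yields the Leibniz rule for [d]. *)
have f2 x p : (f x p).2 = x * p.2.
  pose S : {pred AB} := fun x => `[< forall p, (f x p).2 = x * p.2 >].
  have : x \in S.
    apply: (free_product_ind freeAB) => [|a|b].
    - split; first by apply/asboolP => q; rewrite f1 mul1r.
        move=> c u v /asboolP uS /asboolP vS; apply/asboolP => q.
        by rewrite f_lin /= uS vS mulrDl -scalerAl.
      move=> u v /asboolP uS /asboolP vS; apply/asboolP => q.
      by rewrite fM uS vS mulrA.
    - by apply/asboolP => q; rewrite fA.
    - by apply/asboolP => q; rewrite fB.
  by move/asboolP.
have fE x p z : (f x p).1 z = p.1 (z * x) + d x (p.2 * z).
  pose S : {pred AB} := fun x => `[< forall p z,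
    (f x p).1 z = p.1 (z * x) + d x (p.2 * z) >].
  have : x \in S.
    apply: (free_product_ind freeAB) => [|a|b].
    - split; first by apply/asboolP => q w; rewrite /d !f1 mulr1 addr0.
        move=> c u v /asboolP uS /asboolP vS; apply/asboolP => q w.
        rewrite f_lin dlin mulrDr -scalerAr endo_linear pair_lin uS vS.
        by rewrite scalerDr addrACA.
      move=> u v /asboolP uS /asboolP vS; apply/asboolP => q w.
      have -> : d (u * v) (q.2 * w) = (f (u * v) (0, 1)).1 (q.2 * w) by [].
      by rewrite !fM !uS !vS !f2 /= add0r mul1r mulr1 !mulrA addrA.
    - by apply/asboolP => q w; rewrite /d !fA /= mul1r add0r.
    - by apply/asboolP => q w; rewrite /d !fB /= mul1r add0r.
  by move/asboolP.
exists d; split=> //.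
- by move=> x y z; rewrite {1}/d fM fE f2 /= mulr1 addrC.
- by move=> a z; rewrite /d fA /= mul1r add0r.
- by move=> b z; rewrite /d fB /= mul1r add0r.
Qed.

End CyclicDerivative.

(** * Spanning by alternating words, and the cyclic derivative *)

Section FreeProductTraces.
Variables (k : fieldType) (A B AB : algType k).
Variables (iA : {lrmorphism A -> AB}) (iB : {lrmorphism B -> AB}).
Hypothesis freeAB : is_free_product iA iB.
Variables (bA : pointed_basis (1 : A)) (bB : pointed_basis (1 : B)).
Notation letter := (letter bA bB).
Notation word_val := (word_val iA iB (bA := bA) (bB := bB)).
Implicit Types (s t w : seq letter).

Let span (x : AB) : Prop := exists s : seq (k * seq letter),
  all (fun p => alternating p.2) s /\ x = \sum_(p <- s) p.1 *: word_val p.2.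

Let span_lin c x y : span x -> span y -> span (c *: x + y).
Proof.
move=> [s [alts ->]] [t [altt ->]].
exists ([seq (c * p.1, p.2) | p <- s] ++ t); split.
  by rewrite all_cat all_map altt andbT; apply: sub_all alts.
rewrite big_cat big_map scaler_sumr; congr (_ + _).
by apply: eq_bigr => p _; rewrite scalerA.
Qed.

Let span0 : span 0.
Proof. by exists [::]; rewrite big_nil. Qed.

Let span_word w : alternating w -> span (word_val w).
Proof. by move=> altw; exists [:: (1, w)]; rewrite /= altw big_seq1 scale1r. Qed.

Let span_sum (I : Type) (r : seq I) (c : I -> k) (F : I -> AB) :
  (forall i, span (F i)) -> span (\sum_(i <- r) c i *: F i).
Proof.
move=> spF; elim: r => [|i r IHr]; first by rewrite big_nil; apply: span0.
by rewrite big_cons; apply: span_lin.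
Qed.

(** Both factors are treated at once. If a word starts in the other factor, expand [a] in the basis;
    otherwise absorb the first letter into [a] beforehand. *)
Let span_mul (D : algType k) (iD : {lrmorphism D -> AB}) (bD : pointed_basis (1 : D))
    (inj : bidx bD -> letter) (side : bool) :
  (forall i, letter_val iA iB (inj i) = iD (bvec bD (Some i))) ->
  (forall i, inA (inj i) = side) -> (forall l, inA l = side -> exists i, l = inj i) ->
  forall a x, span x -> span (iD a * x).
Proof.
move=> injE inj_side side_inj a x.
have base w a' : alternating w -> (if w is l :: _ then side != inA l else true) ->
    span (iD a' * word_val w).
  move=> altw hw; have [s ->] := bvec_span bD a'.
  have -> : iD (\sum_(p <- s) p.1 *: bvec bD p.2) * word_val w =
            \sum_(p <- s) p.1 *: (iD (bvec bD p.2) * word_val w).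
    rewrite linear_sum mulr_suml; apply: eq_bigr => p _.
    by rewrite linearZ /= scalerAl.
  apply: span_sum => -[c [i|]] /=; last first.
    by rewrite bvec_None rmorph1 mul1r; apply: span_word.
  rewrite -injE -word_val_cons; apply: span_word.
  by case: w altw hw => //= l w; rewrite /alternating /= inj_side => -> ->.
move=> [s [alts ->]]; elim: s alts => [|[c w] s IHs] /=.
  by move=> _; rewrite big_nil mulr0; apply: span0.
case/andP=> altw /IHs; rewrite big_cons mulrDr -scalerAr; apply: span_lin => /=.
case: w altw => [|l w] altw; first exact: base.
have [/esym/side_inj[i lE]|l_side] := eqVneq side (inA l); last exact: base.
rewrite word_val_cons lE injE mulrA -rmorphM; apply: base.
  exact: path_sorted altw.
by case: w altw => //= l' w /andP[]; rewrite lE inj_side.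
Qed.

(** The elements whose left multiplication preserves the alternating span form a subalgebra
    containing both factors; apply them to the empty word. *)
Lemma free_product_span x : exists (s : seq (seq letter)) (c : seq letter -> k),
  [/\ uniq s, forall w, w \in s -> alternating w, forall w, w \in s -> c w != 0
    & x = \sum_(w <- s) c w *: word_val w].
Proof.
have [s [alts xE]] : span x.
  pose S : {pred AB} := fun x => `[< forall y, span y -> span (x * y) >].
  have /asboolP/(_ 1) : x \in S.
    apply: (free_product_ind freeAB) => [|a|b].
    - split; first by apply/asboolP => y; rewrite mul1r.
        move=> c u v /asboolP uS /asboolP vS; apply/asboolP => y yS.
        by rewrite mulrDl -scalerAl; apply: span_lin; [apply: uS | apply: vS].
      move=> u v /asboolP uS /asboolP vS; apply/asboolP => y yS.
      by rewrite -mulrA; apply/uS/vS.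
    - apply/asboolP => y.
      by apply: (@span_mul A iA bA inl true) => // -[j|//]; exists j.
    - apply/asboolP => y.
      by apply: (@span_mul B iB bB inr false) => // -[//|j]; exists j.
  rewrite mulr1; apply; have -> : 1 = word_val [::] by rewrite /word_val big_nil.
  exact: span_word.
(* Terms with equal words are merged and zero coefficients dropped. *)
pose c w := \sum_(p <- s | p.2 == w) p.1.
exists [seq w <- undup (map snd s) | c w != 0], c; split.
- exact/filter_uniq/undup_uniq.
- move=> w; rewrite mem_filter mem_undup => /andP[_ /mapP[p ps ->]].
  exact: (allP alts).
- by move=> w; rewrite mem_filter => /andP[].
rewrite big_filter xE big_mkcond /= [RHS]big_mkcond.
rewrite (eq_bigr (fun w => \sum_(p <- s | p.2 == w) p.1 *: word_val w)); last first.
  by move=> w _; rewrite -scaler_suml -/(c w); case: eqVneq => // ->; rewrite scale0r.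
rewrite (exchange_big_dep xpredT) //=; apply: eq_big_seq => p ps.
rewrite big_mkcond (bigD1_seq p.2) ?undup_uniq ?mem_undup ?map_f //= eqxx.
by rewrite big1 ?addr0 // => w /negPf wp; rewrite eq_sym wp.
Qed.

(** At [z = 1] the derivation cuts a word just after and just before each letter of [A]; swapping
    the two pieces gives the two rotations. *)
Lemma exists_cyclic_derivative : exists theta : AB -> AB,
  [/\ linear theta, forall x y, theta (x * y) = theta (y * x)
    & forall s, theta (word_val s) =
        \sum_(i < size s | nth false (map (@inA _ _ _ bA bB) s) i)
          (word_val (rot i.+1 s) - word_val (rot i s))].
Proof.
have [d [d_lin dM dA dB]] := exists_double_derivation freeAB.
exists (d^~ 1); split=> // [x y|s].
  by rewrite !dM !mulr1 !mul1r addrC.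
(* The induction needs a general [z], as the Leibniz rule moves letters into the argument. *)
have d_word z : d (word_val s) z =
    \sum_(i < size s | nth false (map (@inA _ _ _ bA bB) s) i)
      (word_val (drop i.+1 s) * z * word_val (take i.+1 s)
       - word_val (drop i s) * z * word_val (take i s)).
  elim: s z => [|l s IHs] z.
    rewrite big_ord0 /word_val big_nil.
    have /esym/eqP := dM 1 1 z; rewrite !mulr1 mul1r -subr_eq0 addrK.
    by move/eqP.
  rewrite big_mkcond big_ord_recl /= drop0 word_val_cons dM IHs -big_mkcond /=.
  congr (_ + _); last first.
    apply: eq_bigr => i _; rewrite !word_val_cons.
    by rewrite !mulrA.
  rewrite take0 /word_val big_seq1 big_nil mulr1.
  by case: l => [i|j] /=; rewrite ?dA ?dB ?mulrA.
rewrite d_word; apply: eq_bigr => i _.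
by rewrite !mulr1 -!word_val_cat.
Qed.

End FreeProductTraces.

(** * Rotations and coefficients of doubled words *)

(** The doubled word is fixed by rotation through half its length, so injectivity of rotation gives
    [w ++ w' = w' ++ w]. *)
Lemma rot_double_eq (T : eqType) (w w' : seq T) i :
  size w = size w' -> rot i (w ++ w') = w' ++ w' -> w = w'.
Proof.
move=> sw rw.
have : rot i (rot (size w) (w ++ w')) = rot i (w ++ w').
  by rewrite rot_rot rw sw rot_size_cat.
by move/rot_inj/eqP; rewrite rot_size_cat eqseq_cat // => /andP[_ /eqP].
Qed.

Lemma not_scalars_basis (k : fieldType) (A : algType k)
    (bA : pointed_basis (1 : A)) : ~ eq_scalars A -> exists _ : bidx bA, True.
Proof.
move=> nA; apply: contrapT => noidx; apply: nA => a.
have [s ->] := bvec_span bA a; exists (\sum_(p <- s) p.1).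
rewrite scaler_suml; apply: eq_bigr => -[c [i|]] _ /=; last by rewrite bvec_None.
by case: noidx; exists i.
Qed.

Lemma exists_longest (T : eqType) (s : seq (seq T)) : s != [::] ->
  exists2 w, w \in s & forall v, v \in s -> (size v <= size w)%N.
Proof.
elim: s => // w s IHs _; have [->|/IHs[v vs vmax]] := eqVneq s [::].
  by exists w; rewrite ?mem_head // => v; rewrite inE => /eqP->.
have [wv|vw] := leqP (size w) (size v).
  by exists v => [|t]; rewrite inE ?vs ?orbT // => /predU1P[->|/vmax].
exists w => [|t]; first exact: mem_head.
by rewrite inE => /predU1P[->//|/vmax tv]; apply: leq_trans tv (ltnW vw).
Qed.

Section TraceForm.
Variables (k : fieldType) (A B AB : algType k).
Variables (iA : {lrmorphism A -> AB}) (iB : {lrmorphism B -> AB}).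
Variables (bA : pointed_basis (1 : A)) (bB : pointed_basis (1 : B)).
Notation letter := (letter bA bB).
Notation word_val := (word_val iA iB (bA := bA) (bB := bB)).
Notation inA := (@inA _ _ _ bA bB).
Implicit Types (s t u w : seq letter).

(** A letter is added at an end only where needed; the end conditions let the doubled word
    alternate. *)
Lemma alternating_extension (i : bidx bA) (j : bidx bB) w : alternating w ->
  exists p q l w0, [/\ p ++ w ++ q = l :: w0, alternating (l :: w0), inA l
    & ~~ inA (last l w0)].
Proof.
move=> altw.
have [p [l [v [pE altv lA]]]] : exists p l v,
    [/\ p ++ w = l :: v, alternating (l :: v) & inA l].
  case: w altw => [|[i'|j'] w] altw.
  - by exists [:: inl i], (inl i), [::].
  - by exists [::], (inl i'), w.
  - by exists [:: inl i], (inl i), (inr j' :: w).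
case lastA: (inA (last l v)); last first.
  by exists p, [::], l, v; rewrite cats0 lastA.
exists p, [:: inr j], l, (rcons v (inr j)).
rewrite catA pE cats1 /= last_rcons; split=> //.
by rewrite /alternating /= rcons_path lastA /= andbT.
Qed.

(* The coefficient of a cyclic word in the cyclic derivative. Since u starts
   with a letter of A and ends with a letter of B, only the terms with negative
   sign contribute. *)
Lemma word_coef_cyclic_derivative (e : AB -> k) (theta : AB -> AB) l v t :
  let u := l :: v in
  linear (e : AB -> k^o) -> ~~ inA (last l v) ->
  (forall t, (size t <= size u)%N -> e (word_val t) = (t == u)%:R) ->
  (forall s, theta (word_val s) =
        \sum_(i < size s | nth false (map inA s) i)
          (word_val (rot i.+1 s) - word_val (rot i s))) ->
  (size t <= size u)%N ->
  e (theta (word_val t)) =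
    - (\sum_(i < size t | nth false (map inA t) i) (rot i t == u))%:R.
Proof.
move=> u e_lin lastu eE thetaE tu.
pose l' : {linear AB -> k^o} := HB.pack e
  (GRing.isLinear.Build k AB k^o *:%R e e_lin).
rewrite thetaE -[LHS]/(l' _) linear_sum natr_sum -sumrN; apply: eq_bigr => i iA'.
rewrite linearB /= !eE ?size_rot //.
(* This rotation ends with the letter of [t] at position [i], which is in [A], whereas [u] ends in
   [B]. *)
suff /negPf-> : rot i.+1 t != u by rewrite sub0r.
apply: contraNneq lastu => rE.
have -> : last l v = last l (rot i.+1 t) by rewrite rE.
rewrite /rot last_cat (take_nth l) // last_rcons.
by rewrite (nth_map l) in iA'.
Qed.

End TraceForm.

Theorem corollary2p2 (k : fieldType) (A B AB : algType k)
    (iA : {lrmorphism A -> AB}) (iB : {lrmorphism B -> AB}) :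
  [pchar k] =i pred0 ->
  ~ eq_scalars A ->
  ~ eq_scalars B ->
  is_free_product iA iB ->
  traces_separate_cocenter AB ->
  RFD AB.
Proof.
move=> /pcharf0P char0 nA nB freeAB sep x /eqP x_neq0.
have [bA _] := exists_pointed_basis (oner_neq0 A).
have [bB _] := exists_pointed_basis (oner_neq0 B).
have [i0 _] := not_scalars_basis bA nA; have [j0 _] := not_scalars_basis bB nB.
have [s [c [s_uniq s_alt c_neq0 xE]]] := free_product_span freeAB bA bB x.
have [|w1 w1s w1max] := @exists_longest _ s.
  by apply: contraNneq x_neq0 => s0; rewrite xE s0 big_nil.
have [p [q [l [v [w0E altw0 lA lastB]]]]] := alternating_extension i0 j0 (s_alt _ w1s).
set w0 := l :: v in w0E altw0.
have altu : alternating (w0 ++ w0).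
  rewrite /alternating /= cat_path /=; move: altw0; rewrite /alternating /= => ->.
  by rewrite lA (negPf lastB).
have [e [e_lin eE]] := exists_word_coef freeAB altu.
have [theta [theta_lin thetaC thetaE]] := exists_cyclic_derivative freeAB bA bB.
pose word_val := @word_val _ _ _ _ iA iB bA bB.
(* [phi] vanishes on commutators, while [phi y] detects the coefficient of [w1] in [x]: the trailing
   [w0] turns the term of [w1] into the doubled word. *)
pose y := word_val p * x * word_val (q ++ w0).
pose phi z := e (theta z).
have phi_lin : linear (phi : AB -> k^o).
  by move=> a z z'; rewrite /phi theta_lin e_lin.
pose phiL : {linear AB -> k^o} := HB.pack phi
  (GRing.isLinear.Build k AB k^o *:%R phi phi_lin).
have phi_w w : w \in s -> phi (word_val (p ++ w ++ q ++ w0)) =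
    if w == w1 then phi (word_val (w0 ++ w0)) else 0.
  move=> ws; case: eqVneq => [->|ww1].
    by rewrite !catA -[(p ++ w1) ++ q]catA w0E.
  (* The choice of a longest [w1] secures the length bound of the coefficient functional. *)
  have sz : (size (p ++ w ++ q ++ w0) <= size (w0 ++ w0))%N.
    by rewrite -w0E !size_cat !addnA !leq_add2r leq_add2l w1max.
  rewrite /phi (word_coef_cyclic_derivative e_lin _ eE thetaE) ?last_cat //.
  rewrite big1 ?oppr0 // => i _; apply/eqP; rewrite eqb0; apply: contraNneq ww1 => rotE.
  have rE : rot i (p ++ w ++ q ++ w0) = w0 ++ w0 := rotE.
  (* Rotation preserves length, so [p ++ w ++ q] is as long as [w0]; [rot_double_eq] identifies
     them, and cancelling [p] and [q] gives [w = w1]. *)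
  have sE : size (p ++ w ++ q) = size w0.
    by apply/(@addIn (size w0)); rewrite -!size_cat -rE size_rot -!catA.
  have := @rot_double_eq _ (p ++ w ++ q) w0 i sE; rewrite -!catA => /(_ rE)/eqP.
  rewrite -w0E eqseq_cat // eqxx /= eqseq_cat => [/andP[//]|].
  by move/eqP: sE; rewrite -w0E !size_cat eqn_add2l eqn_add2r => /eqP.
have phiy : phi y = c w1 * phi (word_val (w0 ++ w0)).
  have -> : y = \sum_(w <- s) c w *: word_val (p ++ w ++ q ++ w0).
    rewrite /y xE mulr_sumr mulr_suml; apply: eq_bigr => w _.
    by rewrite -scalerAr -scalerAl /word_val !word_val_cat !mulrA.
  rewrite -[LHS]/(phiL _) linear_sum (bigD1_seq w1) // linearZ /=.
  rewrite phi_w // eqxx big1_seq ?addr0 // => w /andP[ww1 ws].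
  by rewrite -[LHS]/(phiL _) linearZ /= phi_w // (negPf ww1) scaler0.
(* The trivial rotation is counted because [w0] begins in [A], so the count is positive;
   characteristic zero keeps it nonzero in [k]. *)
have phiu : phi (word_val (w0 ++ w0)) != 0.
  rewrite /phi (word_coef_cyclic_derivative e_lin _ eE thetaE) ?last_cat //.
  by rewrite oppr_eq0 char0 -lt0n /= big_mkcond big_ord_recl /= lA rot0 eqxx.
have [|rho rho_y] := sep y.
  move/eqP; rewrite cocenter_eq0 => /asboolP[r yE].
  have : phi y = 0.
    rewrite yE -[LHS]/(phiL _) linear_sum big1 // => t _.
    by rewrite linearZ linearB /= /phi thetaC subrr scaler0.
  move/eqP; rewrite phiy mulf_eq0 (negPf phiu) orbF; apply/negP.
  exact: c_neq0.
(* As [x] is a factor of [y], [rho x = 0] would force [rho y = 0] and a zero trace. *)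
exists rho => rho_x; apply: rho_y.
rewrite /y !rep_mul rho_x comp_lfun0r comp_lfun0l /lftrace.
have b := vbasisP {: rep_space rho}.
by have /eqP-> := etrans (passmx.mxof_eq0 b b 0) (eqxx _); rewrite mxtrace0.
Qed.
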